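(* For every $f\in C[-1,1]$, the error of Simpson's rule on $[-1,1]$ satisfies $$\left|\frac12\int_{-1}^1 f(t)\,dt-\left\{\frac{f(-1)+f(1)}{6}+\frac23 f(0)\right\}\right|\le 4\,575\,650\,119\,680\cdot\omega_4\left(f;\sqrt[4]{\tfrac12\cdot\tfrac1{2880}\cdot 2^4}\right).$$
   Context: $\omega_4(f;h)$ is the usual fourth order modulus of smoothness on $[-1,1]$ in the sup norm: $\omega_4(f;h)=\sup\left\{\left|\sum_{j=0}^4(-1)^{4-j}\binom4j f(y+jt)\right|:\ 0\le t\le h,\ y,\,y+4t\in[-1,1]\right\}$. Note $\sqrt[4]{\frac12\cdot\frac1{2880}\cdot2^4}=360^{-1/4}=0.2295\ldots$. *)

(* Defs.v *)
From Stdlib Require Import Reals.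
From Coquelicot Require Import Coquelicot.
Open Scope R_scope.

(* [Binomial.C] is the binomial coefficient; a bare [C] would be Coquelicot's
   type of complex numbers.  [sum_f_R0 F 4] has the five terms F 0, ..., F 4. *)
Definition diff4 (f : R -> R) (y t : R) : R :=
  sum_f_R0 (fun j => (-1) ^ (4 - j) * Binomial.C 4 j * f (y + INR j * t)) 4.

Definition omega4_set (f : R -> R) (h : R) : R -> Prop :=
  fun v => exists t y : R,
    0 <= t <= h /\ -1 <= y <= 1 /\ -1 <= y + 4 * t <= 1 /\
    v = Rabs (diff4 f y t).

(* For h >= 0 and f continuous on [-1,1] the set is nonempty and bounded, so the
   supremum in Rbar is finite and the projection [real] loses nothing. *)
Definition omega4 (f : R -> R) (h : R) : R := real (Lub_Rbar (omega4_set f h)).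

(* An element of C[-1,1] is a total function restricted to [-1,1]: continuity is
   relative to the interval, hence one-sided at the endpoints, and values
   outside it are unconstrained. *)
Definition continuous_on_m11 (f : R -> R) : Prop :=
  continuous_on (fun x => -1 <= x <= 1) f.

(* Main.v *)
Require Import Defs.
From Stdlib Require Import Reals.
From Coquelicot Require Import Coquelicot.
From Stdlib Require Import Lra Lia.
Open Scope R_scope.

(** Let [F] be a primitive of [f], and let [s = 1/5], which is at most
    [360^(-1/4)].  Integrating [diff4 f y t] over [0 <= t <= s] expresses
    [s * f y] through values of [F] at [y + j s] with error at most [s * omega];
    this eliminates [f (-1)], [f 0] and [f 1] from Simpson's rule.  What remains
    is a functional of the values [F (k / 5)], [|k| <= 5], that vanishes on
    quartics, hence a combination of fifth differences of [F]; each of these is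
    the integral of [diff4 f y s] over a [y]-interval of length [s], so it is at
    most [s * omega]. *)

(** Composing with [clamp] extends [f] by its endpoint values to a function continuous on all of R,
    whose primitive is differentiable everywhere, the endpoints included. *)
Definition clamp (x : R) : R := Rmax (-1) (Rmin 1 x).

Lemma clamp_bounds x : -1 <= clamp x <= 1.
Proof. unfold clamp, Rmax, Rmin; repeat destruct Rle_dec; lra. Qed.

Lemma clamp_id x : -1 <= x <= 1 -> clamp x = x.
Proof. unfold clamp, Rmax, Rmin; repeat destruct Rle_dec; lra. Qed.

Lemma clamp_contracting x y : Rabs (clamp y - clamp x) <= Rabs (y - x).
Proof.
  unfold clamp, Rmax, Rmin; repeat destruct Rle_dec;
    unfold Rabs; repeat destruct Rcase_abs; lra.
Qed.

Lemma continuous_clamp f :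
  continuous_on_m11 f -> forall x, continuous (fun y => f (clamp y)) x.
Proof.
  intros hf x P HP.
  destruct (hf (clamp x) (clamp_bounds x) P HP) as [e He].
  exists e; intros y Hy.
  apply He; [ | apply clamp_bounds].
  eapply Rle_lt_trans; [apply clamp_contracting | exact Hy].
Qed.

Lemma diff4E f y t :
  diff4 f y t =
  f y - 4 * f (y + t) + 6 * f (y + 2 * t) - 4 * f (y + 3 * t) + f (y + 4 * t).
Proof.
  unfold diff4, Binomial.C; simpl.
  replace (y + 0 * t) with y by ring.
  replace (y + 1 * t) with (y + t) by ring.
  replace (y + (1 + 1) * t) with (y + 2 * t) by ring.
  replace (y + (1 + 1 + 1) * t) with (y + 3 * t) by ring.
  replace (y + (1 + 1 + 1 + 1) * t) with (y + 4 * t) by ring.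
  field.
Qed.

(** The coefficients 1, -4, 6, -4, 1 are palindromic, so the nodes may be read from either end. This
    brings backward steps under [omega4], which only admits [t >= 0]. *)
Lemma diff4_opp f y t : diff4 f y (- t) = diff4 f (y - 4 * t) t.
Proof.
  rewrite !diff4E.
  replace (y - 4 * t + t) with (y + 3 * - t) by ring.
  replace (y - 4 * t + 2 * t) with (y + 2 * - t) by ring.
  replace (y - 4 * t + 3 * t) with (y + - t) by ring.
  replace (y - 4 * t + 4 * t) with y by ring.
  replace (y - 4 * t) with (y + 4 * - t) by ring.
  ring.
Qed.

Lemma diff4_ext f g y t :
  -1 <= y <= 1 -> -1 <= y + 4 * t <= 1 ->
  (forall x, -1 <= x <= 1 -> f x = g x) -> diff4 f y t = diff4 g y t.
Proof. intros Hy Hyt E; rewrite !diff4E, !E; lra. Qed.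

Lemma omega4_set_le_omega4 f h v :
  continuous_on_m11 f -> omega4_set f h v -> v <= omega4 f h.
Proof.
  intros hf Hv.
  destruct (bounded_continuity (fun y => f (clamp y)) (-1) 1) as [M HM].
  { intros x _; exact (continuous_clamp f hf x). }
  assert (HMf : forall x, -1 <= x <= 1 -> Rabs (f x) < M).
  { intros x Hx; generalize (HM x Hx).
    rewrite (clamp_id x Hx); exact (fun H => H). }
  destruct (Lub_Rbar_correct (omega4_set f h)) as [ub lub].
  assert (le_lub := ub v Hv).
  (* [real] sends infinite values to 0, so finiteness is needed: 16 is the sum of the absolute
     values of the coefficients, and the member [v] excludes minus infinity. *)
  assert (lub_le : Rbar_le (Lub_Rbar (omega4_set f h)) (16 * M)).
  { apply lub; intros w (t & y & Ht & Hy & Hyt & ->); simpl.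
    rewrite diff4E.
    assert (B0 := HMf y ltac:(lra)).
    assert (B1 := HMf (y + t) ltac:(lra)).
    assert (B2 := HMf (y + 2 * t) ltac:(lra)).
    assert (B3 := HMf (y + 3 * t) ltac:(lra)).
    assert (B4 := HMf (y + 4 * t) ltac:(lra)).
    apply Rabs_def2 in B0, B1, B2, B3, B4; apply Rabs_le; lra. }
  unfold omega4.
  destruct (Lub_Rbar (omega4_set f h)); simpl in *; tauto.
Qed.

Lemma diff4_le_omega4 f h y t :
  continuous_on_m11 f -> Rabs t <= h -> -1 <= y <= 1 -> -1 <= y + 4 * t <= 1 ->
  Rabs (diff4 f y t) <= omega4 f h.
Proof.
  intros hf Ht Hy Hyt; apply omega4_set_le_omega4; [exact hf | ].
  destruct (Rle_or_lt 0 t) as [t0 | t0].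
  - rewrite Rabs_pos_eq in Ht by exact t0.
    exists t, y; repeat split; lra.
  - rewrite Rabs_left in Ht by exact t0.
    exists (- t), (y + 4 * t); repeat split; try lra.
    replace (diff4 f y t) with (diff4 f y (- - t)) by now rewrite Ropp_involutive.
    rewrite diff4_opp; do 2 f_equal; ring.
Qed.

(** Takes the place of integrating a bound on [dphi]; the endpoints are unordered, so that backward
    steps are covered. *)
Lemma mean_value_bound (phi dphi : R -> R) a b M :
  (forall x, is_derive phi x (dphi x)) ->
  (forall x, Rmin a b <= x <= Rmax a b -> Rabs (dphi x) <= M) ->
  Rabs (phi b - phi a) <= M * Rabs (b - a).
Proof.
  intros Hd HM.
  destruct (MVT_gen phi a b dphi) as (c & Hc & ->).
  - intros x _; apply Hd.
  - intros x _; apply continuity_pt_filterlim.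
    apply (ex_derive_continuous phi x); eexists; apply Hd.
  - rewrite Rabs_mult.
    apply Rmult_le_compat_r; [apply Rabs_pos | apply HM, Hc].
Qed.

(** The fifth difference is the increment of [diff4 F x s] from [x = y] to [x = y + s], and the
    derivative of that function in [x] is [diff4 g x s]. *)
Lemma fifth_difference_bound (F g : R -> R) y s W :
  (forall x, is_derive F x (g x)) ->
  (forall x, Rmin y (y + s) <= x <= Rmax y (y + s) -> Rabs (diff4 g x s) <= W) ->
  Rabs (F (y + 5 * s) - 5 * F (y + 4 * s) + 10 * F (y + 3 * s)
        - 10 * F (y + 2 * s) + 5 * F (y + s) - F y) <= W * Rabs s.
Proof.
  intros HF HW.
  assert (H := mean_value_bound (fun x => diff4 F x s) (fun x => diff4 g x s)
                 y (y + s) W).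
  replace (y + s - y) with s in H by ring.
  rewrite !diff4E in H.
  replace (y + s + s) with (y + 2 * s) in H by ring.
  replace (y + s + 2 * s) with (y + 3 * s) in H by ring.
  replace (y + s + 3 * s) with (y + 4 * s) in H by ring.
  replace (y + s + 4 * s) with (y + 5 * s) in H by ring.
  eapply Rle_trans; [right | apply H; [ | exact HW]].
  - f_equal; ring.
  - intros x.
    apply (is_derive_ext (fun x => F x - 4 * F (x + s) + 6 * F (x + 2 * s)
                                   - 4 * F (x + 3 * s) + F (x + 4 * s))).
    { intros u; symmetry; apply diff4E. }
    auto_derive.
    + repeat split; eexists; apply HF.
    + rewrite diff4E.
      rewrite !(fun u => is_derive_unique F u _ (HF u)); ring.
Qed.

(** In the antiderivative of [diff4 g y t] in [t], the coefficient of [F (y + j * t)] is that of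
    [g (y + j * t)] divided by [j]: -4, 6/2, -4/3, 1/4. These add up to -25/12, whence the term in
    [F y]. *)
Lemma node_value_bound (F g : R -> R) y s W :
  (forall x, is_derive F x (g x)) ->
  (forall t, Rmin 0 s <= t <= Rmax 0 s -> Rabs (diff4 g y t) <= W) ->
  Rabs (s * g y + 25 / 12 * F y - 4 * F (y + s) + 3 * F (y + 2 * s)
        - 4 / 3 * F (y + 3 * s) + 1 / 4 * F (y + 4 * s)) <= W * Rabs s.
Proof.
  intros HF HW.
  assert (H := mean_value_bound
                 (fun t => t * g y - 4 * F (y + t) + 3 * F (y + 2 * t)
                           - 4 / 3 * F (y + 3 * t) + 1 / 4 * F (y + 4 * t))
                 (fun t => diff4 g y t) 0 s W).
  cbv beta in H; rewrite !Rmult_0_r, !Rplus_0_r, Rminus_0_r in H.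
  eapply Rle_trans; [right | apply H; [ | exact HW]].
  - f_equal; field.
  - intros t; auto_derive.
    + repeat split; eexists; apply HF.
    + rewrite diff4E.
      rewrite !(fun u => is_derive_unique F u _ (HF u)); field.
Qed.

Lemma grid_functional_bound (F g : R -> R) W :
  (forall x, is_derive F x (g x)) ->
  (forall y t, Rabs t <= 1 / 5 -> -1 <= y <= 1 -> -1 <= y + 4 * t <= 1 ->
     Rabs (diff4 g y t) <= W) ->
  Rabs (1 / 2 * (F 1 - F (-1)) - ((g (-1) + g 1) / 6 + 2 / 3 * g 0))
  <= 4575650119680 * W.
Proof.
  intros HF HW.
  set (G := fun k : Z => F (IZR k / 5)).
  (* For these six [k], the window from [k / 5] to [(k + 5) / 5] stays within [-1,1]. *)
  assert (fifth : forall k, (-5 <= k <= 0)%Z ->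
    Rabs (G (k + 5)%Z - 5 * G (k + 4)%Z + 10 * G (k + 3)%Z
          - 10 * G (k + 2)%Z + 5 * G (k + 1)%Z - G k) <= W / 5).
  { intros k [k1 k2]; apply IZR_le in k1, k2; unfold G; rewrite !plus_IZR.
    replace (W / 5) with (W * Rabs (1 / 5)) by (rewrite Rabs_pos_eq; lra).
    eapply Rle_trans; [right | apply (fifth_difference_bound F g (IZR k / 5))].
    - assert (E : forall a, (IZR k + a) / 5 = IZR k / 5 + a * (1 / 5))
        by (intros; field).
      now rewrite !E, Rmult_1_l.
    - exact HF.
    - intros x; rewrite Rmin_left, Rmax_right by lra; intros Hx.
      apply HW; [rewrite Rabs_pos_eq | | ]; lra. }
  assert (node : forall k e, (e = 1 \/ e = -1)%Z -> (-5 <= k <= 5)%Z ->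
    (-5 <= k + 4 * e <= 5)%Z ->
    Rabs (IZR e / 5 * g (IZR k / 5) + 25 / 12 * G k - 4 * G (k + e)%Z
          + 3 * G (k + 2 * e)%Z - 4 / 3 * G (k + 3 * e)%Z
          + 1 / 4 * G (k + 4 * e)%Z)
    <= W / 5).
  { intros k e He [k1 k2] [l1 l2]; apply IZR_le in k1, k2, l1, l2; unfold G.
    rewrite !plus_IZR, !mult_IZR in *.
    replace (W / 5) with (W * Rabs (IZR e / 5))
      by (destruct He as [-> | ->];
          [rewrite Rabs_pos_eq | rewrite Rabs_left]; lra).
    eapply Rle_trans; [right | apply (node_value_bound F g (IZR k / 5))].
    - assert (E : forall a, (IZR k + a * IZR e) / 5 = IZR k / 5 + a * (IZR e / 5))
        by (intros; field).
      now rewrite !E, Rdiv_plus_distr.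
    - exact HF.
    (* [t] lies between 0 and [e / 5], so [y + 4 * t] lies between two grid points of [-1,1]. *)
    - intros t Ht.
      apply HW; destruct He as [-> | ->];
        (rewrite Rmin_left, Rmax_right in Ht by lra) ||
        (rewrite Rmin_right, Rmax_left in Ht by lra);
        try (apply Rabs_le); lra. }
  assert (F1 := fifth (-5)%Z ltac:(lia)).
  assert (F2 := fifth (-4)%Z ltac:(lia)).
  assert (F3 := fifth (-3)%Z ltac:(lia)).
  assert (F4 := fifth (-2)%Z ltac:(lia)).
  assert (F5 := fifth (-1)%Z ltac:(lia)).
  assert (F6 := fifth 0%Z ltac:(lia)).
  (* Forward from -1 and 0 but backward from 1, so that all nodes remain in [-1,1]. *)
  assert (N1 := node (-5)%Z 1%Z ltac:(lia) ltac:(lia) ltac:(lia)).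
  assert (N2 := node 0%Z 1%Z ltac:(lia) ltac:(lia) ltac:(lia)).
  assert (N3 := node 5%Z (-1)%Z ltac:(lia) ltac:(lia) ltac:(lia)).
  simpl Z.add in *.
  replace (F 1) with (G 5%Z) by (unfold G; f_equal; lra).
  replace (F (-1)) with (G (-5)%Z) by (unfold G; f_equal; lra).
  replace (-5 / 5) with (-1) in N1 by field.
  replace (0 / 5) with 0 in N2 by field.
  replace (5 / 5) with 1 in N3 by field.
  clear fifth node HF HW.
  apply Rabs_le_between in F1, F2, F3, F4, F5, F6, N1, N2, N3.
  (* One certificate: weights 5/6, 10/3, 5/6 on [N1], [N2], [N3], and 89, 205, 315, 335, 145, 89
     over 72 on [F1] to [F6], up to sign. The total is [769/180 * W], far below the claim; [W >= 0]
     follows from [F1]. *)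
  apply Rabs_le; lra.
Qed.

(** The radicand is 1/360, above (1/5)^4 = 1/625. Among steps 1/n, which put -1, 0 and 1 on one
    grid, 1/5 is the largest allowed, as 1/256 exceeds 1/360. *)
Lemma fifth_le_step : 1 / 5 <= Rpower (1 / 2 * (1 / 2880) * 2 ^ 4) (1 / 4).
Proof.
  apply Rle_trans with (Rpower ((1 / 5) ^ 4) (1 / 4)).
  - rewrite <- Rpower_pow, Rpower_mult by lra.
    replace (INR 4 * (1 / 4)) with 1 by (simpl; field).
    rewrite Rpower_1; lra.
  - apply Rle_Rpower_l; lra.
Qed.

Theorem mainTheorem4 (f : R -> R) (hf : continuous_on_m11 f) :
  Rabs (1 / 2 * RInt f (-1) 1 - ((f (-1) + f 1) / 6 + 2 / 3 * f 0))
  <= 4575650119680 * omega4 f (Rpower (1 / 2 * (1 / 2880) * 2 ^ 4) (1 / 4)).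
Proof.
  set (h := Rpower _ _).
  set (g := fun x => f (clamp x)).
  assert (gf : forall x, -1 <= x <= 1 -> g x = f x).
  { intros x Hx; unfold g; now rewrite clamp_id. }
  assert (g_cont := continuous_clamp f hf : forall x, continuous g x).
  set (F := fun x => RInt g (-1) x).
  assert (HF : forall x, is_derive F x (g x)).
  { intros x; apply (is_derive_RInt g F (-1)); [ | apply g_cont].
    apply filter_forall; intros u; apply (RInt_correct (V := R_CompleteNormedModule)).
    apply (ex_RInt_continuous (V := R_CompleteNormedModule)); intros; apply g_cont. }
  assert (F_int : RInt f (-1) 1 = F 1 - F (-1)).
  { unfold F; rewrite (RInt_point (V := R_CompleteNormedModule) (-1) g).
    change (@zero R_CompleteNormedModule) with 0; rewrite Rminus_0_r.
    apply RInt_ext; intros x; rewrite Rmin_left, Rmax_right by lra; intros Hx.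
    symmetry; apply gf; lra. }
  rewrite F_int, <- !gf by lra.
  apply grid_functional_bound; [exact HF | ].
  intros y t Ht Hy Hyt.
  rewrite (diff4_ext g f) by assumption.
  apply diff4_le_omega4; try assumption.
  eapply Rle_trans; [exact Ht | exact fifth_le_step].
Qed.
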